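(* Let $\mathcal A_+,\mathcal A_-\subseteq\mathbb R^n$ be disjoint finite sets such that $(\mathcal A_+,\mathcal A_-)$ is nonseparable. (i) If $f\in\mathcal S(\mathcal A_+,\mathcal A_-)$ satisfies $\operatorname{Sing}_{>0}(f)\neq\varnothing$, then $f$ is SONC. (ii) If moreover $\mathcal A_+,\mathcal A_-\subseteq\mathbb Z^n$, then $\nabla_{>0}(\mathcal A_+,\mathcal A_-)\subseteq\mathcal C_{\mathrm{SONC}}(\mathcal A_+,\mathcal A_-)$ and $\nabla_{>0}(\mathcal A_+,\mathcal A_-)=\partial\,\mathcal C(\mathcal A_+,\mathcal A_-)$, the boundary being taken in $\mathbb R^{\mathcal A}_{>0}$.
   Context: A signomial with signed support $(\mathcal A_+,\mathcal A_-)$ is $f_c(x)=\sum_{a\in\mathcal A_+}c_ax^a-\sum_{b\in\mathcal A_-}c_bx^b$ on $\mathbb R^n_{>0}$ with $c\in\mathbb R^{\mathcal A}_{>0}$, $\mathcal A=\mathcal A_+\cup\mathcal A_-$; $\mathcal S(\mathcal A_+,\mathcal A_-)$ is the set of these, identified with $\mathbb R^{\mathcal A}_{>0}$. $\operatorname{Sing}_{>0}(f)$ is the set of $x\in\mathbb R^n_{>0}$ with $f(x)=x_i\partial_{x_i}f(x)=0$ for all $i$; $\nabla_{>0}(\mathcal A_+,\mathcal A_-)=\{c:\operatorname{Sing}_{>0}(f_c)\neq\varnothing\}$. Let $d=\dim\operatorname{conv}(\mathcal A)$; $\mathcal F(\mathcal A_+)$ is the common refinement of all regular polyhedral subdivisions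 of $\mathcal A_+$, $\mathcal F_d(\mathcal A_+)$ its $d$-cells; $(\mathcal A_+,\mathcal A_-)$ is nonseparable if $\mathcal A_-\subseteq\operatorname{relint}\operatorname{conv}(\mathcal A_+)$ and some $D\in\mathcal F_d(\mathcal A_+)$ contains $\mathcal A_-$. A signed support $(\mathcal B_+,\mathcal B_-)$ is a circuit if either $\#(\mathcal B_+\cup\mathcal B_-)=\#\mathcal B_+=1$, or $\operatorname{conv}(\mathcal B_+\cup\mathcal B_-)$ is a simplex with vertex set $\mathcal B_+$, $\#\mathcal B_-=1$ and $\mathcal B_-\subseteq\operatorname{relint}\operatorname{conv}(\mathcal B_+)$. A signomial is SONC if it is a finite sum of copositive (nonnegative on $\mathbb R^n_{>0}$) signomials with circuit signed supports. $\mathcal C_{\mathrm{SONC}}(\mathcal A_+,\mathcal A_-)$ and $\mathcal C(\mathcal A_+,\mathcal A_-)$ denote the SONC, resp. copositive, elements of $\mathcal S(\mathcal A_+,\mathcal A_-)$. *)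

(* Defs.v *)
From HB Require Import structures.
From mathcomp Require Import all_boot all_order all_algebra.
From mathcomp Require Import all_classical all_reals all_analysis.
Set Implicit Arguments. Unset Strict Implicit. Unset Printing Implicit Defensive.
Import Order.TTheory GRing.Theory Num.Theory.
Import numFieldNormedType.Exports.
Local Open Scope classical_set_scope.
Local Open Scope ring_scope.

Section Signomials.
Variable R : realType.
Variable n : nat.

Definition posorth (x : 'rV[R]_n) : Prop := forall k, 0 < x 0 k.

Definition monom (a x : 'rV[R]_n) : R := \prod_(k < n) (x 0 k) `^ (a 0 k).

(** A signomial with signed support given by the injective families
    Ap : 'I_p -> R^n (the set A_+) and Am : 'I_m -> R^n (the set A_-);
    its coefficient vector c in R^A is indexed by 'I_(p + m): the coefficient of
    Ap i is c 0 (lshift m i) and that of Am j is c 0 (rshift p j). *)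
Definition signomial p m (Ap : 'I_p -> 'rV[R]_n) (Am : 'I_m -> 'rV[R]_n)
  (c : 'rV[R]_(p + m)) (x : 'rV[R]_n) : R :=
  \sum_(i < p) c 0 (lshift m i) * monom (Ap i) x
  - \sum_(j < m) c 0 (rshift p j) * monom (Am j) x.

Definition signed_support p m (Ap : 'I_p -> 'rV[R]_n) (Am : 'I_m -> 'rV[R]_n) : Prop :=
  injective Ap /\ injective Am /\ (forall i j, Ap i <> Am j).

Definition poscoef N (c : 'rV[R]_N) : Prop := forall k, 0 < c 0 k.

Definition partial (f : 'rV[R]_n -> R) (i : 'I_n) (x : 'rV[R]_n) : R :=
  derive1 (fun t : R => f (\row_j (if j == i then t else x 0 j))) (x 0 i).

Definition Sing_pos (f : 'rV[R]_n -> R) : set 'rV[R]_n :=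
  [set x | posorth x /\ f x = 0 /\ forall i, x 0 i * partial f i x = 0].

Definition copositive (f : 'rV[R]_n -> R) : Prop := forall x, posorth x -> 0 <= f x.

Definition dotv (w a : 'rV[R]_n) : R := \sum_(k < n) w 0 k * a 0 k.

Definition conv_sub q (B : 'I_q -> 'rV[R]_n) (C : pred 'I_q) : set 'rV[R]_n :=
  [set x | exists l : 'I_q -> R, (forall i, 0 <= l i) /\ (forall i, ~~ C i -> l i = 0)
     /\ \sum_(i < q) l i = 1 /\ x = \sum_(i < q) l i *: B i].

Definition conv q (B : 'I_q -> 'rV[R]_n) : set 'rV[R]_n := conv_sub B predT.

Definition aff q (B : 'I_q -> 'rV[R]_n) : set 'rV[R]_n :=
  [set x | exists l : 'I_q -> R, \sum_(i < q) l i = 1 /\ x = \sum_(i < q) l i *: B i].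

Definition relint_conv q (B : 'I_q -> 'rV[R]_n) : set 'rV[R]_n :=
  [set x | conv B x /\ exists e : R, 0 < e /\
     forall y, aff B y -> (forall k, `|y 0 k - x 0 k| < e) -> conv B y].

Definition aff_indep q (B : 'I_q -> 'rV[R]_n) : Prop :=
  forall l : 'I_q -> R, \sum_(i < q) l i = 0 -> \sum_(i < q) l i *: B i = 0 ->
    forall i, l i = 0.

Definition affdim (S : set 'rV[R]_n) (d : nat) : Prop :=
  (exists v : 'I_d.+1 -> 'rV[R]_n, (forall i, S (v i)) /\ aff_indep v) /\
  (forall v : 'I_d.+2 -> 'rV[R]_n, (forall i, S (v i)) -> ~ aff_indep v).

Definition union_fam p m (Ap : 'I_p -> 'rV[R]_n) (Am : 'I_m -> 'rV[R]_n)
  : 'I_(p + m) -> 'rV[R]_n := fun k => match fintype.split k with inl i => Ap i | inr j => Am j end.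

(** Regular subdivisions of A_+: for a height function h, the cells are the
    lower faces of conv{(a, h(a))}, i.e. for w in R^n the set of points
    minimizing h(a) + <w, a>. *)
Definition lower_cell p (Ap : 'I_p -> 'rV[R]_n) (h : 'I_p -> R) (w : 'rV[R]_n) : pred 'I_p :=
  fun i => [forall j, h i + dotv w (Ap i) <= h j + dotv w (Ap j)].

(** D is a cell of the common refinement F(A_+) of all regular subdivisions of
    A_+ of dimension d: D is the intersection, over all height functions h, of
    a cell (chosen by W h) of the regular subdivision induced by h, and dim D = d. *)
Definition refinement_dcell p (Ap : 'I_p -> 'rV[R]_n) (d : nat) (D : set 'rV[R]_n) : Prop :=
  (exists W : ('I_p -> R) -> 'rV[R]_n,
     D = [set x | forall h, conv_sub Ap (lower_cell Ap h (W h)) x]) /\ affdim D d.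

Definition nonseparable p m (Ap : 'I_p -> 'rV[R]_n) (Am : 'I_m -> 'rV[R]_n) : Prop :=
  (forall j, relint_conv Ap (Am j)) /\
  exists d, affdim (conv (union_fam Ap Am)) d /\
    exists D, refinement_dcell Ap d D /\ forall j, D (Am j).

Definition circuit q r (Bp : 'I_q -> 'rV[R]_n) (Bm : 'I_r -> 'rV[R]_n) : Prop :=
  (q = 1%N /\ r = 0%N) \/
  (r = 1%N /\ conv (union_fam Bp Bm) = conv Bp /\ aff_indep Bp /\
   forall j, relint_conv Bp (Bm j)).

Record sig_data := SigData {
  sd_q : nat; sd_r : nat;
  sd_Bp : 'I_sd_q -> 'rV[R]_n; sd_Bm : 'I_sd_r -> 'rV[R]_n;
  sd_c : 'rV[R]_(sd_q + sd_r) }.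
Arguments sd_Bp : clear implicits.
Arguments sd_Bm : clear implicits.
Arguments sd_c : clear implicits.

Definition sd_fun (s : sig_data) : 'rV[R]_n -> R :=
  signomial (sd_Bp s) (sd_Bm s) (sd_c s).

Definition copos_circuit (s : sig_data) : Prop :=
  signed_support (sd_Bp s) (sd_Bm s) /\ poscoef (sd_c s) /\
  circuit (sd_Bp s) (sd_Bm s) /\ copositive (sd_fun s).

Definition SONC (f : 'rV[R]_n -> R) : Prop :=
  exists (N : nat) (F : 'I_N -> sig_data), (forall k, copos_circuit (F k)) /\
    forall x, posorth x -> f x = \sum_(k < N) sd_fun (F k) x.

Definition nabla_pos p m (Ap : 'I_p -> 'rV[R]_n) (Am : 'I_m -> 'rV[R]_n) : set 'rV[R]_(p + m) :=
  [set c | poscoef c /\ Sing_pos (signomial Ap Am c) !=set0].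

Definition C_SONC p m (Ap : 'I_p -> 'rV[R]_n) (Am : 'I_m -> 'rV[R]_n) : set 'rV[R]_(p + m) :=
  [set c | poscoef c /\ SONC (signomial Ap Am c)].

Definition C_copos p m (Ap : 'I_p -> 'rV[R]_n) (Am : 'I_m -> 'rV[R]_n) : set 'rV[R]_(p + m) :=
  [set c | poscoef c /\ copositive (signomial Ap Am c)].

End Signomials.

(** boundary of S relative to the open set P (here P = R^A_{>0}, S a subset of P):
    since P is open, bd_P(S) = P \cap closure S \ interior S. *)
Definition rel_boundary (R : realType) N (P S : set 'rV[R]_N) : set 'rV[R]_N :=
  P `&` (closure S `\` interior S).

(* Main.v *)
(** Fix a positive singular point x* and put lambda_i = c_i x*^(a_i),
    mu_j = c_j x*^(b_j).  Singularity says that the measures lambda on A_+ and mu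
    on A_- have the same mass and the same barycentre.  By Farkas' lemma lambda
    splits as a sum of measures lambda^(j) of mass mu_j and barycentre b_j, unless
    some height function h on A_+ obstructs it; but the b_j lie in a common cell of
    the regular subdivision induced by h, on which the lower convex envelope of h
    is affine, and this excludes the obstruction.  Each lambda^(j) then splits
    into measures with affinely independent supports, and each of these gives a
    weighted AM-GM inequality with equality at x*, that is, a copositive circuit
    signomial.

    For the boundary: lowering a coefficient of A_+ makes a signomial with a positive
    zero negative somewhere.  Conversely, since A_- lies in the relative interior of
    conv(A_+), a copositive signomial without positive zero is, after rescaling by a
    monomial, bounded below by a positive constant on a compact set outside of which
    all nearby signomials are positive; so it is interior.  At a zero of a
    copositive signomial the gradient vanishes. *)

Require Import Defs.
From HB Require Import structures.
From mathcomp Require Import all_boot all_order all_algebra.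
From mathcomp Require Import all_classical all_reals all_analysis.
From mathcomp Require Import ring lra.
Import Order.TTheory GRing.Theory Num.Theory.
Import numFieldNormedType.Exports.
Local Open Scope classical_set_scope.
Local Open Scope ring_scope.

(** * Farkas' lemma for finitely many linear functionals *)

Definition linear_form (R : realType) (V : lmodType R) (f : V -> R) : Prop :=
  forall k x y, f (k *: x + y) = k * f x + f y.

(* Bartl's proof: if [x0] violates the implication for the first functionals,
   the last one can be eliminated by projecting along [x0] onto its kernel. *)
Lemma farkas (R : realType) (V : lmodType R) (I : eqType) (r : seq I)
    (a : I -> V -> R) (c : V -> R) :
  uniq r -> (forall i, linear_form R V (a i)) -> linear_form R V c ->
  (forall x, (forall i, i \in r -> a i x <= 0) -> c x <= 0) ->
  exists l : I -> R, (forall i, 0 <= l i) /\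
    forall x, c x = \sum_(i <- r) l i * a i x.
Proof.
elim: r a c => [|i0 r IH] a c.
  move=> _ _ lc nc; exists (fun=> 0); split=> // x; rewrite big_nil.
  have cx y : c y <= 0 by apply: nc.
  apply/eqP; rewrite eq_le cx /=.
  have := cx (- x); have := lc (-1) x 0; have := lc 0 0 0.
  rewrite !scaleN1r !addr0 scaler0 mul0r add0r => _ ->.
  by have := lc 1 0 0; rewrite scale1r addr0; lra.
move=> /= /andP[i0r ur] la lc nc.
have [h|] := pselect (forall x, (forall i, i \in r -> a i x <= 0) -> c x <= 0).
  have [l [l0 lE]] := IH a c ur la lc h.
  exists (fun i => if i == i0 then 0 else l i); split=> [i|x].
    by case: ifP.
  rewrite big_cons eqxx mul0r add0r lE; apply: eq_big_seq => i ir.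
  by case: eqP ir i0r => // ->->.
move=> /existsNP[x1] /not_implyP[ax1 /negP]; rewrite -ltNge => cx1.
have a0x1 : 0 < a i0 x1.
  rewrite ltNge; apply/negP => a0; move: cx1; rewrite ltNge nc// => i.
  by rewrite in_cons => /orP[/eqP->|/ax1].
pose k := (a i0 x1)^-1.
have k0 : 0 < k by rewrite invr_gt0.
have linD f y : linear_form R V f ->
    f ((- (k * a i0 y)) *: x1 + y) = f y - (k * f x1) * a i0 y.
  by move=> lf; rewrite lf; ring.
have linP f : linear_form R V f ->
    linear_form R V (fun y => f y - (k * f x1) * a i0 y).
  by move=> lf s x y; rewrite lf la; ring.
have [] := IH (fun i y => a i y - (k * a i x1) * a i0 y)
              (fun y => c y - (k * c x1) * a i0 y) ur.
- by move=> i; exact/linP.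
- exact: linP.
- move=> x ax; rewrite -linD//; apply: nc => i.
  rewrite in_cons => /orP[/eqP->|ir]; rewrite linD//; last exact: ax.
  by rewrite mulVf ?gt_eqF// mul1r subrr.
move=> l [l0 lE].
(* The multiplier of [i0] absorbs the terms subtracted by the projection; it is nonnegative because
   [c x1] is positive and [a j x1] is nonpositive for [j] in [r]. *)
exists (fun i => if i == i0
  then k * c x1 - \sum_(j <- r) l j * (k * a j x1) else l i); split.
  move=> i; case: ifP => // _; rewrite subr_ge0.
  apply: (@le_trans _ _ 0); last by rewrite mulr_ge0// ltW.
  rewrite big_seq sumr_le0// => j jr.
  by rewrite mulr_ge0_le0// mulr_ge0_le0// ?ax1// ltW.
move=> x; rewrite big_cons eqxx.
under eq_big_seq => i ir.
  have -> : (i == i0) = false by apply/eqP => ii; rewrite -ii ir in i0r.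
  over.
have := lE x => /(canRL (subrK _)) ->.
rewrite mulrBl mulr_suml addrC -addrA; congr (_ + _); rewrite -sumrN.
by rewrite -big_split /=; apply: eq_bigr => i _; ring.
Qed.

(** * Linearity of the scalar product *)

Section Dot.
Variables (R : realType) (n : nat).
Implicit Types w a b : 'rV[R]_n.

Lemma dotvZr w k a : dotv w (k *: a) = k * dotv w a.
Proof. by rewrite /dotv mulr_sumr; apply: eq_bigr => i _; rewrite mxE; ring. Qed.

Lemma dotv_sumr w (I : finType) (l : I -> R) (B : I -> 'rV[R]_n) :
  dotv w (\sum_i l i *: B i) = \sum_i l i * dotv w (B i).
Proof.
under [RHS]eq_bigr do rewrite -dotvZr.
rewrite /dotv exchange_big /=; apply: eq_bigr => k _.
by rewrite summxE mulr_sumr.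
Qed.

Lemma dotvBr w a b : dotv w (a - b) = dotv w a - dotv w b.
Proof. by rewrite /dotv -sumrB; apply: eq_bigr => i _; rewrite !mxE mulrBr. Qed.

Lemma dotvBl a b w : dotv (a - b) w = dotv a w - dotv b w.
Proof. by rewrite /dotv -sumrB; apply: eq_bigr => i _; rewrite !mxE mulrBl. Qed.

Lemma dotvZDl k a b w : dotv (k *: a + b) w = k * dotv a w + dotv b w.
Proof.
rewrite /dotv mulr_sumr -big_split; apply: eq_bigr => i _; rewrite !mxE /=; ring.
Qed.

Lemma dotv_delta k a : dotv (delta_mx 0 k) a = a 0 k.
Proof.
rewrite /dotv (bigD1 k)//= !mxE !eqxx mul1r big1 ?addr0// => i ik.
by rewrite mxE (negbTE ik) andbF mul0r.
Qed.

Lemma dotv0l a : dotv 0 a = 0.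
Proof. by rewrite /dotv big1// => i _; rewrite mxE mul0r. Qed.

End Dot.

(** * Distributing the positive weights among the negative exponents *)

Section Splitting.
Variables (R : realType) (n p m : nat).
Variables (Ap : 'I_p -> 'rV[R]_n) (Am : 'I_m -> 'rV[R]_n).

(** [v] is the constant term of the affine function [v - dotv w] that supports [h] from below and
    agrees with it on the cell. *)
Lemma lower_cell_min (h : 'I_p -> R) (w : 'rV[R]_n) :
  exists v, (forall i, v <= h i + dotv w (Ap i)) /\
    forall i, lower_cell Ap h w i -> h i + dotv w (Ap i) = v.
Proof.
have [[i0 /forallP Hi0]|no] := pselect (exists i, lower_cell Ap h w i).
  exists (h i0 + dotv w (Ap i0)); split=> [//|i /forallP Hi].
  by apply/eqP; rewrite eq_le Hi Hi0.
have [p0|/card_gt0P[i0 _]] := posnP #|'I_p|.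
  by exists 0; split=> i; have := fintype0 i p0.
exfalso; apply: no.
case: (arg_minP (fun i => h i + dotv w (Ap i)) (erefl : xpredT i0)) => i _ H.
by exists i; apply/forallP => j; exact: H.
Qed.

(* The dual certificate of the transportation problem is a height function
   together with affine functions below it; it is refuted by the common cell. *)
Lemma split_weights (W : ('I_p -> R) -> 'rV[R]_n)
    (lam : 'I_p -> R) (mu : 'I_m -> R) :
  (forall h j, conv_sub Ap (lower_cell Ap h (W h)) (Am j)) ->
  (forall i, 0 <= lam i) -> (forall j, 0 <= mu j) ->
  \sum_i lam i = \sum_j mu j ->
  \sum_i lam i *: Ap i = \sum_j mu j *: Am j ->
  exists l : 'I_m -> 'I_p -> R, [/\ forall j i, 0 <= l j i,
    forall i, \sum_j l j i = lam i,
    forall j, \sum_i l j i = mu j &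
    forall j, \sum_i l j i *: Ap i = mu j *: Am j].
Proof.
move=> cellW lam0 mu0 sumE momE.
(* A vector of [V] encodes a negated height function on A_+ and, for each [j], the constant and the
   gradient of an affine function; [a (j, i) x <= 0] puts the [j]-th affine function below the
   height at [Ap i]. The Farkas multipliers are the desired [l j i]. *)
pose V : lmodType R := (('rV[R]_p * 'rV[R]_m) * 'M[R]_(m, n))%type.
pose a (k : 'I_m * 'I_p) (x : V) : R :=
  x.1.1 0 k.2 + x.1.2 0 k.1 + dotv (row k.1 x.2) (Ap k.2).
pose c (x : V) : R := \sum_i lam i * x.1.1 0 i +
  \sum_j mu j * (x.1.2 0 j + dotv (row j x.2) (Am j)).
have la k : linear_form R V (a k).
  move=> s x y; rewrite /a.
  rewrite (_ : row _ _ = s *: row k.1 x.2 + row k.1 y.2); last exact: linearP.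
  by rewrite dotvZDl !mxE; ring.
have lc : linear_form R V c.
  move=> s x y; rewrite /c !mulrDr !mulr_sumr addrACA -!big_split /=.
  congr (_ + _); apply: eq_bigr => i _; first by rewrite !mxE; ring.
  rewrite (_ : row i _ = s *: row i x.2 + row i y.2); last exact: linearP.
  by rewrite dotvZDl !mxE; ring.
have [|l [l0 lE]] :=
    farkas R V _ (index_enum _) a c (index_enum_uniq _) la lc.
  move=> x ax.
  have {}ax i j : x.1.2 0 j + dotv (row j x.2) (Ap i) <= - x.1.1 0 i.
    by have := ax (j, i) (mem_index_enum _); rewrite /a /=; lra.
  pose h i := - x.1.1 0 i; pose w := W h.
  have [v [vle veq]] := lower_cell_min h w.
  have b_le j : x.1.2 0 j + dotv (row j x.2) (Am j) <= v - dotv w (Am j).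
    have [t [t0 [tC [t1 ->]]]] := cellW h j.
    rewrite !dotv_sumr -[x.1.2 0 j]mul1r -[v]mul1r -t1 !mulr_suml.
    rewrite -sumrB -big_split /=; apply: ler_sum => i _.
    have [/veq Hi|/tC ->] := boolP (lower_cell Ap h (W h) i); last first.
      by rewrite !mul0r addr0 subr0.
    rewrite -mulrDr -mulrBr ler_wpM2l//; apply: le_trans (ax _ _) _.
    by rewrite -/(h i) -Hi addrK.
  (* Both sums are now compared with the single affine function [v - dotv w], on which equal mass
     and equal moment cancel. *)
  apply: (@le_trans _ _ (\sum_i lam i * (dotv w (Ap i) - v) +
      \sum_j mu j * (v - dotv w (Am j)))).
    apply: lerD; apply: ler_sum => i _; rewrite ler_wpM2l//.
    by have := vle i; rewrite /h; lra.
  rewrite le_eqVlt; apply/orP; left; apply/eqP.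
  under eq_bigr do rewrite mulrBr.
  under [X in _ + X]eq_bigr do rewrite mulrBr.
  by rewrite !sumrB -!dotv_sumr -!mulr_suml sumE momE; ring.
have {}lE x : c x = \sum_j \sum_i l (j, i) * a (j, i) x.
  by rewrite lE pair_bigA /=; apply: eq_bigr => -[].
(* Testing the identity on the coordinate vectors of the three factors of [V] gives the two
   marginals and the moment equations. *)
exists (fun j i => l (j, i)); split => //.
- move=> i; have := lE ((delta_mx 0 i, 0), 0); rewrite /c /a /=.
  rewrite (bigD1 i)//= !mxE !eqxx mulr1 big1 ?addr0; last first.
    by move=> k ki; rewrite mxE (negbTE ki) andbF mulr0.
  rewrite big1 ?addr0 => [->|j _]; last first.
    by rewrite row0 dotv0l mxE addr0 mulr0.
  apply: eq_bigr => j _; rewrite (bigD1 i)//= big1 ?addr0.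
    by rewrite !mxE !eqxx row0 dotv0l !addr0 mulr1.
  by move=> k ki; rewrite !mxE (negbTE ki) row0 dotv0l !addr0 mulr0.
- move=> j; have := lE ((0, delta_mx 0 j), 0); rewrite /c /a /=.
  rewrite big1 ?add0r => [|i _]; last by rewrite mxE mulr0.
  rewrite (bigD1 j)//= !mxE !eqxx row0 dotv0l addr0 mulr1 big1 ?addr0; last first.
    by move=> k kj; rewrite mxE (negbTE kj) row0 dotv0l addr0 mulr0.
  move=> ->; rewrite [RHS](bigD1 j)//= [X in _ = _ + X]big1 ?addr0.
    by apply: eq_bigr => i _; rewrite !mxE !eqxx row0 dotv0l addr0 add0r mulr1.
  move=> k kj; rewrite big1// => i _.
  by rewrite !mxE (negbTE kj) row0 dotv0l !addr0 mulr0.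
- move=> j; apply/rowP => k; have := lE ((0, 0), delta_mx j k); rewrite /c /a /=.
  have rowd : row j (delta_mx j k) = delta_mx 0 k :> 'rV[R]_n.
    by apply/rowP => q; rewrite !mxE eqxx.
  have rowd0 j' : j' != j -> row j' (delta_mx j k) = 0 :> 'rV[R]_n.
    by move=> jj; apply/rowP => q; rewrite !mxE (negbTE jj).
  rewrite big1 ?add0r => [|i _]; last by rewrite mxE mulr0.
  rewrite (bigD1 j)//= rowd dotv_delta !mxE add0r big1 ?addr0; last first.
    by move=> j' jj; rewrite rowd0// dotv0l mxE addr0 mulr0.
  move=> ->; rewrite summxE [RHS](bigD1 j)//= [X in _ = _ + X]big1 ?addr0.
    by apply: eq_bigr => i _; rewrite rowd dotv_delta !mxE !add0r.
  move=> j' jj; rewrite big1// => i _.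
  by rewrite rowd0// dotv0l !mxE !addr0 mulr0.
Qed.

End Splitting.

(** * Weighted AM-GM forms and circuit signomials *)

Section AGIforms.
Variables (R : realType) (n : nat).
Implicit Types (a b x z : 'rV[R]_n).

Lemma gt0_lower_bound (I : finType) (t : I -> R) : (forall i, 0 < t i) ->
  exists tau, 0 < tau /\ forall i, tau <= t i.
Proof.
(* The default 1 keeps the minimum positive over an empty index type. *)
move=> t0; exists (\big[Num.min/1]_i t i); split=> [|i].
  by apply: lt_bigmin => // i _; exact: t0.
exact: bigmin_le.
Qed.

Definition logv x : 'rV[R]_n := \row_k ln (x 0 k).

Lemma monomE a x : posorth x -> monom a x = expR (dotv (logv x) a).
Proof.
move=> x0; rewrite /monom /dotv expR_sum; apply: eq_bigr => k _.
by rewrite /powR gt_eqF ?x0// mxE mulrC.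
Qed.

Lemma monom_gt0 a x : posorth x -> 0 < monom a x.
Proof. by move=> x0; rewrite monomE// expR_gt0. Qed.

(* Tangent line of the exponential at [dotv z b]. *)
Lemma agiform_ge0 (I : finType) (t : I -> R) (B : I -> 'rV[R]_n) b z :
  (forall i, 0 <= t i) -> \sum_i t i *: B i = (\sum_i t i) *: b ->
  (\sum_i t i) * expR (dotv z b) <= \sum_i t i * expR (dotv z (B i)).
Proof.
move=> t0 tE.
have -> : (\sum_i t i) * expR (dotv z b) =
    \sum_i t i * (expR (dotv z b) * (1 + (dotv z (B i) - dotv z b))).
  have tB : \sum_i t i * (dotv z (B i) - dotv z b) = 0.
    under eq_bigr do rewrite mulrBr.
    by rewrite sumrB -mulr_suml -dotv_sumr tE dotvZr subrr.
  transitivity ((\sum_i t i) * expR (dotv z b) +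
      expR (dotv z b) * \sum_i t i * (dotv z (B i) - dotv z b)).
    by rewrite tB mulr0 addr0.
  rewrite mulr_suml mulr_sumr -big_split /=.
  by apply: eq_bigr => i _; ring.
apply: ler_sum => i _; rewrite ler_wpM2l//.
have {2}-> : dotv z (B i) = dotv z b + (dotv z (B i) - dotv z b) by ring.
by rewrite expRD ler_wpM2l ?expR_ge0// expR_ge1Dx.
Qed.

(** Barycentric coordinates over an affinely independent family depend linearly on the point, so
    positive ones stay nonnegative nearby. *)
Lemma relint_aff_indep q (B : 'I_q -> 'rV[R]_n) (t : 'I_q -> R) :
  aff_indep B -> (forall i, 0 < t i) -> \sum_i t i = 1 ->
  relint_conv B (\sum_i t i *: B i).
Proof.
move=> indB t0 t1; split.
  by exists t; split=> [i|]; [exact: ltW|split].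
(* Affine independence of [B] is linear independence of the rows [(1, B i)]; a right inverse of [M]
   therefore recovers the coordinates. *)
pose M : 'M[R]_(q, 1 + n) := row_mx (const_mx 1) (\matrix_i B i).
have mulM (v : 'rV[R]_q) :
    v *m M = row_mx ((\sum_i v 0 i)%:M) (\sum_i v 0 i *: B i).
  rewrite mul_mx_row; congr row_mx; apply/rowP => k; rewrite !mxE.
    rewrite ord1 /= mulr1n; apply: eq_bigr => i _; by rewrite mxE mulr1.
  by rewrite summxE; apply: eq_bigr => i _; rewrite !mxE.
have freeM : row_free M.
  rewrite -kermx_eq0; apply/rowV0P => v /sub_kermxP; rewrite mulM.
  rewrite -row_mx0 => /eq_row_mx[/rowP/(_ 0)]; rewrite !mxE mulr1n => v0 vB.
  by apply/rowP => i; rewrite mxE (indB _ v0 vB).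
pose P := pinvmx M.
have [tau [tau0 taut]] := gt0_lower_bound _ _ t0.
(* [C] bounds the norm of [P]; the 1 makes it positive. *)
pose C := 1 + \sum_i \sum_k `|P k i|.
have C0 : 0 < C by rewrite ltr_pwDl// sumr_ge0// => i _; rewrite sumr_ge0.
exists (tau / C); split; first by rewrite divr_gt0.
move=> _ [s [s1 ->]] close; exists s; split=> [i|]; last by split.
pose d : 'rV[R]_q := \row_i (s i - t i).
pose y := \sum_i s i *: B i - \sum_i t i *: B i.
have dE : d = row_mx (0 : 'rV_1) y *m P.
  rewrite -[LHS]mulmx1 -(mulmxVp freeM) mulmxA mulM; congr (row_mx _ _ *m _).
    apply/rowP => k; rewrite ord1 !mxE mulr1n.
    under eq_bigr do rewrite mxE.
    by rewrite sumrB s1 t1 subrr.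
  by rewrite /y -sumrB; apply: eq_bigr => j _; rewrite mxE scalerBl.
have : `|d 0 i| <= tau.
  rewrite dE mxE (le_trans (ler_norm_sum _ _ _))//.
  apply: (@le_trans _ _ (\sum_k tau / C * `|P k i|)).
    apply: ler_sum => k _; rewrite normrM ler_wpM2r//.
    case: (split_ordP k) => j ->.
      by rewrite row_mxEl mxE normr0 divr_ge0// ltW.
    by rewrite row_mxEr ltW// /y !mxE; exact: close.
  rewrite -mulr_sumr mulrAC ler_pdivrMr// ler_wpM2l//; first exact: ltW.
  rewrite /C (bigD1 i)//= -subr_ge0.
  have : 0 <= \sum_(i0 < q | i0 != i) \sum_k `|P k i0|.
    by rewrite sumr_ge0// => j _; rewrite sumr_ge0.
  lra.
rewrite mxE ler_norml => /andP[lo _]; have := taut i; lra.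
Qed.

Lemma SONC_ext (f g : 'rV[R]_n -> R) :
  (forall x, posorth x -> f x = g x) -> SONC f -> SONC g.
Proof.
by move=> fg [N [F [cF fE]]]; exists N, F; split=> // x x0; rewrite -fg// fE.
Qed.

Lemma SONC0 : SONC (fun _ : 'rV[R]_n => 0 : R).
Proof.
exists 0%N, (fun i => match i : 'I_0 with Ordinal _ h => False_rect _ (notF h) end).
by split=> [[]|x _]; rewrite ?big_ord0.
Qed.

Lemma SONCD (f g : 'rV[R]_n -> R) : SONC f -> SONC g -> SONC (fun x => f x + g x).
Proof.
move=> [N [F [cF fE]]] [N' [F' [cF' gE]]].
exists (N + N')%N, (fun k => match fintype.split k with
  | inl i => F i | inr i => F' i end); split=> [k|x x0].
  by case: (fintype.split k).
rewrite big_split_ord /= fE// gE//; congr (_ + _); apply: eq_bigr => i _.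
  by case: split_ordP => j /eqP; rewrite ?eq_lshift ?eq_lrshift // => /eqP ->.
by case: split_ordP => j /eqP; rewrite ?eq_rshift ?eq_rlshift // => /eqP ->.
Qed.

Lemma SONC_sum (I : finType) (f : I -> 'rV[R]_n -> R) :
  (forall i, SONC (f i)) -> SONC (fun x => \sum_i f i x).
Proof.
move=> sf; elim: (index_enum I) => [|i r IH].
  by apply: (SONC_ext _ _ _ SONC0) => x _; rewrite big_nil.
by apply: (SONC_ext _ _ _ (SONCD _ _ (sf i) IH)) => x _; rewrite big_cons.
Qed.

Lemma copositive_SONC (f : 'rV[R]_n -> R) : SONC f -> copositive f.
Proof.
move=> [N [F [cF fE]]] x x0; rewrite fE// sumr_ge0// => k _.
by have [_ [_ [_]]] := cF k; exact.
Qed.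

Variable xs : 'rV[R]_n.
Hypothesis xs0 : posorth xs.

(** Each monomial is normalised by its value at [xs], so that the AM-GM inequality becomes an
    equality there; the weights need not sum to 1. *)
Definition agiform (I : finType) (B : I -> 'rV[R]_n) b (t : I -> R) x : R :=
  \sum_i t i * (monom (B i) x / monom (B i) xs) -
  (\sum_i t i) * (monom b x / monom b xs).

Lemma agiform_copositive (I : finType) (B : I -> 'rV[R]_n) b (t : I -> R) :
  (forall i, 0 <= t i) -> \sum_i t i *: B i = (\sum_i t i) *: b ->
  copositive (agiform _ B b t).
Proof.
move=> t0 tE x x0; rewrite /agiform subr_ge0.
have rE a : monom a x / monom a xs = expR (dotv (logv x - logv xs) a).
  by rewrite !monomE// dotvBl expRB.
by rewrite rE; under [leRHS]eq_bigr do rewrite rE; exact: agiform_ge0.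
Qed.

(** A single circuit suffices: the normalised weights are positive barycentric coordinates of [b] in
    the simplex on [B]. *)
Lemma SONC_circuit q (B : 'I_q -> 'rV[R]_n) b (t : 'I_q -> R) :
  (0 < q)%N -> injective B -> (forall i, B i <> b) -> aff_indep B ->
  (forall i, 0 < t i) -> \sum_i t i *: B i = (\sum_i t i) *: b ->
  SONC (agiform _ B b t).
Proof.
move=> q0 injB Bb indB t0 tE.
have T0 : 0 < \sum_i t i.
  by case: q q0 B t injB Bb indB t0 tE => // q _ B t _ _ _ t0 _;
    rewrite big_ord_recl ltr_wpDr ?sumr_ge0// => i _; exact: ltW.
have bE : b = \sum_i (t i / \sum_i t i) *: B i.
  under eq_bigr do rewrite mulrC -scalerA.
  by rewrite -scaler_sumr tE scalerA mulVf ?scale1r// gt_eqF.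
have rb : relint_conv B b.
  rewrite bE; apply: relint_aff_indep => // [i|]; first by rewrite divr_gt0.
  by rewrite -mulr_suml divff// gt_eqF.
pose s := @SigData R n q 1 B (fun=> b)
  (row_mx (\row_i (t i / monom (B i) xs)) (\row_(j < 1) ((\sum_i t i) / monom b xs))).
have sE x : sd_fun s x = agiform _ B b t x.
  rewrite /sd_fun /signomial /agiform big_ord1 row_mxEr mxE; congr (_ - _).
    by apply: eq_bigr => i _; rewrite row_mxEl mxE mulrAC mulrA.
  by rewrite mulrAC mulrA.
exists 1%N, (fun=> s); split=> [_|x x0]; last by rewrite big_ord1 sE.
split; [|split; [|split]].
- by split=> //; split=> [i j _|i j]; [rewrite !ord1|exact: Bb].
- move=> k /=; case: (split_ordP k) => j ->.
    by rewrite row_mxEl mxE divr_gt0// monom_gt0.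
  by rewrite row_mxEr mxE divr_gt0// monom_gt0.
- right; split=> //; split; last by split.
  apply/seteqP; split=> x [l [l0 [_ [l1 ->]]]].
  (* The weight on [b] is redistributed over the vertices by the barycentric coordinates of [b]. *)
  + exists (fun i => l (lshift 1 i) + l (rshift q 0) * (t i / \sum_i t i)).
    split=> [i|]; first by rewrite addr_ge0// mulr_ge0// divr_ge0// ltW.
    split=> //; split.
      rewrite big_split /= -mulr_sumr -mulr_suml divff ?gt_eqF// mulr1.
      by rewrite -l1 big_split_ord /= big_ord1.
    rewrite big_split_ord /= big_ord1.
    under [RHS]eq_bigr do rewrite scalerDl -scalerA.
    rewrite big_split /= -scaler_sumr -bE; congr (_ + _ *: _).
      apply: eq_bigr => i _; rewrite /union_fam.
      by case: split_ordP => j /eqP; rewrite ?eq_lshift ?eq_lrshift // => /eqP ->.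
    rewrite /union_fam.
    by case: split_ordP => j /eqP; rewrite ?eq_rshift ?eq_rlshift.
  + exists (fun k => match fintype.split k with inl i => l i | inr _ => 0 end).
    have lE i : match fintype.split (lshift 1 i) with inl i => l i | inr _ => 0 end = l i.
      by case: split_ordP => j /eqP; rewrite ?eq_lshift ?eq_lrshift // => /eqP ->.
    have rE (i : 'I_1) : match fintype.split (rshift q i) with inl i => l i | inr _ => 0 end = 0.
      by case: split_ordP => j /eqP; rewrite ?eq_rshift ?eq_rlshift.
    split=> [k|]; first by case: (fintype.split k).
    split=> //; split.
      rewrite big_split_ord /= big_ord1 rE addr0.
      by under eq_bigr do rewrite lE.
    rewrite big_split_ord /= big_ord1 rE scale0r addr0.
    apply: eq_bigr => i _; rewrite lE /union_fam.
    by case: split_ordP => j /eqP; rewrite ?eq_lshift ?eq_lrshift // => /eqP ->.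
- by move=> x x0; rewrite sE; apply: agiform_copositive => // i; exact: ltW.
Qed.

End AGIforms.

(** * Reduction to affinely independent supports *)

Section CircuitDecomposition.
Variables (R : realType) (n : nat).

(** The ratio test of the simplex method: moving from [t] along [l] stops when the first coordinate
    reaches zero, and coordinates outside the support stay zero. *)
Lemma shrink_support (I : finType) (t l : I -> R) :
  (forall i, 0 <= t i) -> (forall i, t i = 0 -> l i = 0) ->
  (exists i, l i < 0) ->
  exists alpha, [/\ 0 < alpha, forall i, 0 <= t i + alpha * l i &
    (#|[pred i | (t i + alpha * l i != 0)%R]| <
     #|[pred i | (t i != 0)%R]|)%N].
Proof.
move=> t0 tl [i1 li1].
case: (arg_minP (fun i => t i / - l i) (li1 : (fun i => l i < 0) i1)) => i li imin.
have ti : 0 < t i.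
  by rewrite lt_def t0 andbT; apply: contraTneq li => /tl ->; rewrite ltxx.
have tl0 j : t j = 0 -> t j + t i / - l i * l j = 0.
  by move=> tj; rewrite (tl j tj) tj mulr0 addr0.
exists (t i / - l i); split=> //.
- by rewrite divr_gt0// oppr_gt0.
- move=> j; have [lj|lj] := ltP (l j) 0.
    rewrite -[X in _ + _ * X]opprK mulrN subr_ge0 -ler_pdivlMr ?oppr_gt0//.
    exact: imin.
  by rewrite addr_ge0// mulr_ge0// divr_ge0// oppr_ge0 ltW.
- apply: proper_card; apply/properP; split.
    by apply/fintype.subsetP => j; rewrite !inE; apply: contraNneq => /tl0 ->.
  exists i; rewrite !inE; first by rewrite gt_eqF.
  rewrite invrN mulrN mulNr divfK ?subrr ?eqxx//.
  by rewrite lt_eqF.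
Qed.

Lemma aff_indep_injective p q (B : 'I_p -> 'rV[R]_n) (e : 'I_q -> 'I_p) :
  injective e ->
  (forall l, (forall i, (forall k, e k != i) -> l i = 0) ->
     \sum_i l i = 0 -> \sum_i l i *: B i = 0 -> forall i, l i = 0) ->
  aff_indep (B \o e).
Proof.
move=> inje h l l0 lB k.
have -> : l k = \sum_(k' | e k' == e k) l k'.
  by rewrite (big_pred1 k)// => k'; rewrite (inj_eq inje).
(* The coefficients are pushed forward along [e]. *)
apply: (h (fun i => \sum_(k' | e k' == i) l k')) => [i||].
- by move=> ei; rewrite big_pred0// => k'; apply/negbTE.
- by rewrite -[RHS]l0 [RHS](partition_big e xpredT).
- rewrite -[RHS]lB [RHS](partition_big e xpredT)//=; apply: eq_bigr => i _.
  by rewrite scaler_suml; apply: eq_bigr => k' /eqP ->.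
Qed.

(* If the support of [t] is affinely dependent, moving [t] both ways along a
   dependency until a coordinate vanishes writes it as a sum of two smaller ones. *)
Lemma SONC_agiform p (B : 'I_p -> 'rV[R]_n) b xs (t : 'I_p -> R) :
  posorth xs -> injective B -> (forall i, B i <> b) ->
  (forall i, 0 <= t i) -> \sum_i t i *: B i = (\sum_i t i) *: b ->
  SONC (agiform R n xs _ B b t).
Proof.
move=> xs0 injB Bb; move: {2}(_.+1) (ltnSn #|[pred i | t i != 0]|) => N.
elim: N t => // N IH t; rewrite ltnS => tN t0 tE.
have [ind|] := pselect (forall l : 'I_p -> R, (forall i, t i = 0 -> l i = 0) ->
    \sum_i l i = 0 -> \sum_i l i *: B i = 0 -> forall i, l i = 0).
  (* An independent support, enumerated by [e], carries one circuit unless it is empty. *)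
  pose S := [pred i | t i != 0]; pose e (k : 'I_#|S|) := enum_val k.
  have sumS (V : zmodType) (F : 'I_p -> V) : (forall i, t i = 0 -> F i = 0) ->
      \sum_i F i = \sum_k F (e k).
    move=> F0; rewrite -(big_enum_val F) (bigID (fun i => i \in S))/=.
    by rewrite [X in _ + X]big1 ?addr0// => i /negPn/eqP /F0.
  have [S0|S0] := posnP #|S|.
    apply: (SONC_ext _ _ (fun=> 0) _ _ (SONC0 _ _)) => x _.
    have tz i : t i = 0 by apply/eqP; move/card0_eq: S0 => /(_ i) /negPn.
    by rewrite /agiform !big1 ?mul0r ?subrr// => i _; rewrite tz ?mul0r.
  have inje : injective e by exact: enum_val_inj.
  apply: (SONC_ext _ _ (agiform R n xs _ (B \o e) b (t \o e))) => [x _|].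
    rewrite /agiform [in RHS]sumS; last by move=> i ->; rewrite mul0r.
    by rewrite [X in _ = _ - X * _]sumS.
  apply: SONC_circuit => //.
  - by move=> i j /injB/inje.
  - by move=> i; exact: Bb.
  - apply: aff_indep_injective => // l le l0 lB; apply: ind => // i ti.
    apply: le => k; apply/eqP => ek; have := enum_valP k.
    by rewrite -/(e k) ek inE ti eqxx.
  - move=> k; have := enum_valP k; rewrite inE => tk.
    by rewrite lt_def t0 andbT.
  - by rewrite -[X in _ = X *: _]sumS// -tE [RHS]sumS// => i ->; rewrite scale0r.
move=> /existsNP[l] /not_implyP[tl] /not_implyP[l0] /not_implyP[lB].
move=> /existsNP[i li].
(* A nonzero dependency with zero sum has entries of both signs, so both directions reach a
   vanishing coordinate. *)
have [neg pos] : (exists i, l i < 0) /\ (exists i, - l i < 0).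
  split; apply: contrapT => /forallNP h.
    apply: li; apply/eqP; move: l0 => /eqP; rewrite psumr_eq0 => [/allP h0|j _].
      by apply: (implyP (h0 i _)) => //; exact: mem_index_enum.
    by rewrite leNgt; apply/negP/h.
  apply: li; apply/eqP; rewrite -oppr_eq0; move: l0 => /eqP.
  rewrite -oppr_eq0 -sumrN psumr_eq0 => [/allP h0|j _].
    by apply: (implyP (h0 i _)) => //; exact: mem_index_enum.
  by rewrite leNgt; apply/negP/h.
have [u [u0 tu ucard]] := shrink_support _ t l t0 tl neg.
have tNl j : t j = 0 -> - l j = 0 by move=> /tl ->; rewrite oppr0.
have [v [v0 tv vcard]] := shrink_support _ t (fun j => - l j) t0 tNl pos.
have part k w : 0 < k -> (forall j, 0 <= t j + w * l j) ->
    (#|[pred j | (t j + w * l j != 0)%R]| < #|[pred j | (t j != 0)%R]|)%N ->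
    SONC (agiform R n xs _ B b (fun j => k * (t j + w * l j))).
  move=> k0 tw wcard; apply: IH.
  - have -> : #|[pred j | k * (t j + w * l j) != 0]| = #|[pred j | t j + w * l j != 0]|.
      by apply: eq_card => j; rewrite !inE mulf_eq0 gt_eqF.
    exact: leq_trans wcard tN.
  - by move=> j; rewrite mulr_ge0// ltW.
  - have -> : \sum_j k * (t j + w * l j) = k * \sum_j t j.
      by rewrite -mulr_sumr big_split /= -[X in _ + X]mulr_sumr l0 mulr0 addr0.
    under eq_bigr do rewrite -scalerA scalerDl -scalerA.
    rewrite -scaler_sumr big_split /= -[X in _ + X]scaler_sumr lB scaler0 addr0.
    by rewrite tE scalerA.
(* The weights [v / (u + v)] and [u / (u + v)] recombine [t + u l] and [t - v l] into [t], the
   multiples of [l] cancelling. *)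
have su : 0 < v / (u + v) by rewrite divr_gt0// addr_gt0.
have sv : 0 < u / (u + v) by rewrite divr_gt0// addr_gt0.
have pv := part _ (- v) sv _ _; have pu := part _ u su tu ucard.
have vE j : t j + v * - l j = t j + - v * l j by rewrite mulrN mulNr.
have {}pv := pv (fun j => eq_ind _ (fun r => 0 <= r) (tv j) _ (vE j)).
have {}pv : SONC (agiform R n xs _ B b (fun j => u / (u + v) * (t j + - v * l j))).
  by apply: pv; rewrite (eq_card (B := [pred j | t j + v * - l j != 0]))// => j;
    rewrite !inE vE.
apply: (SONC_ext _ _ _ _ _ (SONCD _ _ _ _ pu pv)) => x _.
rewrite /agiform addrACA -opprD -mulrDl -!big_split /=.
have uv : u + v != 0 by rewrite gt_eqF// addr_gt0.
have E j : v / (u + v) * (t j + u * l j) + u / (u + v) * (t j + - v * l j) = t j.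
  by field.
congr (_ - _ * _); apply: eq_bigr => j _; last exact: E.
by rewrite -mulrDl E.
Qed.

End CircuitDecomposition.

(** * Logarithmic derivatives and singular points *)

Section SingularPoints.
Variables (R : realType) (n p m : nat).
Variables (Ap : 'I_p -> 'rV[R]_n) (Am : 'I_m -> 'rV[R]_n).
Implicit Types (a x : 'rV[R]_n) (c : 'rV[R]_(p + m)).

Definition upd x k (t : R) : 'rV[R]_n := \row_j (if j == k then t else x 0 j).

Lemma upd_id x k : upd x k (x 0 k) = x.
Proof. by apply/rowP => j; rewrite mxE; case: eqP => // ->. Qed.

Lemma is_derive_monom a x k : posorth x ->
  is_derive (x 0 k) 1 (fun t => monom a (upd x k t)) (a 0 k * monom a x / x 0 k).
Proof.
move=> x0.
pose C := \prod_(j < n | j != k) (x 0 j) `^ (a 0 j).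
have -> : (fun t => monom a (upd x k t)) = C *: (fun t => t `^ (a 0 k)).
  apply/funext => t; rewrite /monom (bigD1 k)//= mxE eqxx mulrC.
  rewrite [RHS]/GRing.scale /=; congr (_ * _); apply: eq_bigr => j jk.
  by rewrite mxE (negbTE jk).
apply: is_derive_eq.
  by apply: is_deriveZ; exact: is_derive1_powR (x0 k).
rewrite /monom (bigD1 k)//= -/C /GRing.scale /= powRB; last first.
  by apply/implyP => _; rewrite gt_eqF ?x0.
by rewrite powRr1 ?ltW//; ring.
Qed.

Lemma is_derive_signomial c x k : posorth x ->
  is_derive (x 0 k) 1 (fun t => signomial Ap Am c (upd x k t))
    ((\sum_i c 0 (lshift m i) * monom (Ap i) x * Ap i 0 k -
      \sum_j c 0 (rshift p j) * monom (Am j) x * Am j 0 k) / x 0 k).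
Proof.
move=> x0.
have -> : (fun t => signomial Ap Am c (upd x k t)) =
   \sum_i (c 0 (lshift m i) *: (fun t => monom (Ap i) (upd x k t))) -
   \sum_j (c 0 (rshift p j) *: (fun t => monom (Am j) (upd x k t))).
  by apply/funext => t; rewrite !fct_sumE.
apply: is_derive_eq.
  apply: is_deriveB; apply: is_derive_sum => i; apply: is_deriveZ;
    exact: is_derive_monom.
rewrite mulrBl !mulr_suml; congr (_ - _); apply: eq_bigr => i _;
  by rewrite /GRing.scale /=; ring.
Qed.

Lemma partial_signomial c x k : posorth x ->
  x 0 k * partial (signomial Ap Am c) k x =
  \sum_i c 0 (lshift m i) * monom (Ap i) x * Ap i 0 k -
  \sum_j c 0 (rshift p j) * monom (Am j) x * Am j 0 k.
Proof.
move=> x0; rewrite /partial derive1E.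
have [_ ->] := is_derive_signomial c x k x0.
by rewrite mulrC divfK// gt_eqF.
Qed.

(** Along each coordinate a zero of a nonnegative function is a minimum, where the derivative
    vanishes. *)
Lemma Sing_pos_min c x : posorth x -> signomial Ap Am c x = 0 ->
  copositive (signomial Ap Am c) -> Sing_pos (signomial Ap Am c) x.
Proof.
move=> x0 fx0 cop; split=> //; split=> // k.
suff -> : partial (signomial Ap Am c) k x = 0 by rewrite mulr0.
have x0k : 0 < x 0 k by [].
have der y : 0 < y ->
    derivable (fun t => signomial Ap Am c (upd x k t)) y 1.
  move=> y0; have uy0 : posorth (upd x k y).
    by move=> j; rewrite mxE; case: ifP.
  have := is_derive_signomial c (upd x k y) k uy0; rewrite [upd _ _ _ 0 k]mxE eqxx.
  have -> : upd (upd x k y) k = upd x k.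
    by apply/funext => t; apply/rowP => j; rewrite !mxE; case: eqP.
  by case.
rewrite /partial derive1E.
have : is_derive (x 0 k) 1 (fun t => signomial Ap Am c (upd x k t)) 0.
  apply: (@derive1_at_min R _ 0 (x 0 k + 1)).
  - by rewrite addr_ge0// ltW.
  - by move=> t; rewrite in_itv /= => /andP[t0 _]; exact: der.
  - by rewrite in_itv /= x0k ltrDl ltr01.
  - move=> t; rewrite in_itv /= => /andP[t0 _]; rewrite upd_id fx0; apply: cop.
    by move=> j; rewrite mxE; case: ifP.
by case.
Qed.

(** The operator [x_k d/dx_k] multiplies each term by the [k]-th coordinate of its exponent, so the
    singular equations compare masses and first moments. *)
Lemma Sing_pos_balance c x : Sing_pos (signomial Ap Am c) x ->
  \sum_i c 0 (lshift m i) * monom (Ap i) x =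
    \sum_j c 0 (rshift p j) * monom (Am j) x /\
  \sum_i (c 0 (lshift m i) * monom (Ap i) x) *: Ap i =
    \sum_j (c 0 (rshift p j) * monom (Am j) x) *: Am j.
Proof.
move=> [x0 [fx0 dx0]]; split; first by apply/eqP; rewrite -subr_eq0; apply/eqP.
apply/rowP => k; apply/eqP; rewrite -subr_eq0 !summxE.
have := dx0 k; rewrite partial_signomial// => E; apply/eqP; rewrite -[RHS]E.
by congr (_ - _); apply: eq_bigr => i _; rewrite mxE.
Qed.

Lemma SONC_of_Sing_pos c : signed_support Ap Am -> nonseparable Ap Am ->
  poscoef c -> Sing_pos (signomial Ap Am c) !=set0 -> SONC (signomial Ap Am c).
Proof.
move=> [injA [_ disj]] [_ [d [_ [D [[[W DE] _] DAm]]]]] c0 [x Sx].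
have [sumE momE] := Sing_pos_balance c x Sx; have [x0 _] := Sx.
have cellW h j : conv_sub Ap (lower_cell Ap h (W h)) (Am j).
  by have := DAm j; rewrite DE; exact.
have wt0 k a : 0 <= c 0 k * monom a x.
  by rewrite mulr_ge0 ?ltW// ?c0// monom_gt0.
have [l [l0 lp lm lM]] := split_weights R n p m Ap Am W
  (fun i => c 0 (lshift m i) * monom (Ap i) x)
  (fun j => c 0 (rshift p j) * monom (Am j) x) cellW
  (fun i => wt0 _ _) (fun j => wt0 _ _) sumE momE.
(* Each [l j] weights an AM-GM form normalised at [x] with inner exponent [Am j]; the marginals of
   [l] restore the coefficients of the signomial. *)
apply: (SONC_ext _ _ (fun y => \sum_j agiform R n x _ Ap (Am j) (l j) y)).
  move=> y y0; rewrite /agiform sumrB /signomial; congr (_ - _).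
    rewrite exchange_big; apply: eq_bigr => i _; rewrite -mulr_suml lp.
    by field; rewrite gt_eqF// monom_gt0.
  apply: eq_bigr => j _; rewrite lm.
  by field; rewrite gt_eqF// monom_gt0.
apply: SONC_sum => j; apply: SONC_agiform => //.
by rewrite lm lM.
Qed.

End SingularPoints.

(** * Perturbing coefficients; the boundary of the copositive set *)

Section CopositiveBoundary.
Variables (R : realType) (n p m : nat).
Variables (Ap : 'I_p -> 'rV[R]_n) (Am : 'I_m -> 'rV[R]_n).
Implicit Types (c : 'rV[R]_(p + m)) (z : 'rV[R]_n).

(** The hull of the whole support has a dimension, so the support is nonempty, and a point of A_-
    would itself lie in the hull of A_+. *)
Lemma nonseparable_inhabited : nonseparable Ap Am -> exists i : 'I_p, True.
Proof.
move=> [rel [d [[[v [cv _]] _] _]]].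
have [l [_ [_ [l1 _]]]] := cv ord0.
have [p0|/card_gt0P[i _]] := posnP #|'I_p|; last by exists i.
have noI (F : 'I_p -> R) : \sum_i F i = 0.
  by rewrite big1// => i _; have := fintype0 i p0.
move: l1; rewrite big_split_ord /= noI add0r.
have [m0|/card_gt0P[j _]] := posnP #|'I_m|.
  by rewrite big1 => [/esym/eqP|j _]; [rewrite oner_eq0|have := fintype0 j m0].
by have [[s [_ [_ [/esym/eqP]]]]] := rel j; rewrite noI oner_eq0.
Qed.

(* [b] lies on the segment from the barycentre to a point of the convex hull
   slightly beyond [b]. *)
Lemma relint_pos_weights (b : 'rV[R]_n) : relint_conv Ap b ->
  exists t : 'I_p -> R, (forall i, 0 < t i) /\
    \sum_i t i = 1 /\ b = \sum_i t i *: Ap i.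
Proof.
move=> [[s [_ [_ [s1 sb]]]] [e [e0 He]]].
have p0 : (0 < p)%N.
  by rewrite lt0n; apply/eqP => p0; subst p; move: s1 => /esym/eqP;
    rewrite big_ord0 oner_eq0.
have pR : 0 < p%:R :> R by rewrite ltr0n.
have pinv1 : \sum_(i < p) (p%:R^-1 : R) = 1.
  by rewrite sumr_const card_ord -[X in X = _]mulr_natl divff// gt_eqF.
pose g : 'rV[R]_n := \sum_i p%:R^-1 *: Ap i.
(* [N] exceeds every [|b - g|] coordinate, so a step of length [u] past [b] stays within the radius
   [e]. *)
pose N := 1 + \sum_k `|(b - g) 0 k|.
have N0 : 0 < N by rewrite ltr_pwDl// sumr_ge0.
pose u := e / N; have u0 : 0 < u by rewrite divr_gt0.
have u1 : 0 < 1 + u by rewrite addr_gt0.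
have [|k|r [r0 [_ [r1 rE]]]] := He (b + u *: (b - g)).
- exists (fun i => s i + u * (s i - p%:R^-1)); split.
    by rewrite big_split /= -mulr_sumr sumrB s1 pinv1 subrr mulr0 addr0.
  rewrite {1 2}sb /g -sumrB scaler_sumr -big_split; apply: eq_bigr => i _ /=.
  by rewrite scalerDl -scalerA scalerBl.
- rewrite mxE addrAC subrr add0r mxE normrM gtr0_norm// /u mulrAC.
  rewrite ltr_pdivrMr// ltr_pM2l// /N (bigD1 k)//= addrCA ltrDl.
  by rewrite ltr_pwDl// sumr_ge0.
(* [b] is the mean, with weights 1 and [u], of the point beyond it and [g]; the share of [g] makes
   every coefficient positive. *)
exists (fun i => (r i + u * p%:R^-1) / (1 + u)); split; last split.
- by move=> i; rewrite divr_gt0// ltr_wpDl// mulr_gt0// invr_gt0.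
- by rewrite -mulr_suml big_split /= -mulr_sumr r1 pinv1 mulr1 divff// gt_eqF.
under eq_bigr do rewrite mulrC -scalerA scalerDl -scalerA.
rewrite -scaler_sumr big_split /= -scaler_sumr -rE -/g -addrA -scalerDr subrK.
by rewrite -{2}[b]scale1r -scalerDl scalerA mulVf ?scale1r// gt_eqF.
Qed.

(** The monomial values are left free, so that one perturbation estimate covers both evaluation at a
    point and the rescaled exponential form. *)
Definition signed_sum c (u : 'I_p -> R) (v : 'I_m -> R) : R :=
  \sum_i c 0 (lshift m i) * u i - \sum_j c 0 (rshift p j) * v j.

Lemma signed_sum_perturb c c' u v eta :
  (forall i, 0 <= u i) -> (forall j, 0 <= v j) ->
  (forall k, `|c 0 k - c' 0 k| <= eta) ->
  `|signed_sum c u v - signed_sum c' u v| <= eta * (\sum_i u i + \sum_j v j).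
Proof.
move=> u0 v0 cc.
have -> : signed_sum c u v - signed_sum c' u v =
    \sum_i (c 0 (lshift m i) - c' 0 (lshift m i)) * u i -
    \sum_j (c 0 (rshift p j) - c' 0 (rshift p j)) * v j.
  under eq_bigr do rewrite mulrBl.
  under [X in _ = _ - X]eq_bigr do rewrite mulrBl.
  by rewrite !sumrB /signed_sum; ring.
rewrite (le_trans (ler_normB _ _))// mulrDr !mulr_sumr.
by apply: lerD; rewrite (le_trans (ler_norm_sum _ _ _))//; apply: ler_sum => i _;
  rewrite normrM [X in _ * X]ger0_norm ?ler_wpM2r.
Qed.

Lemma ball_rV c c' eta : ball c eta c' -> forall k, `|c 0 k - c' 0 k| < eta.
Proof. by move=> [_ cc] k; have := cc 0 k; rewrite -ball_normE. Qed.

(** At a fixed point the value is linear in the coefficients, so a negative value would persist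
    nearby. *)
Lemma closure_C_copos c : closure (C_copos Ap Am) c ->
  copositive (signomial Ap Am c).
Proof.
move=> clc x x0; rewrite leNgt; apply/negP => fx.
pose u i := monom (Ap i) x; pose v j := monom (Am j) x.
have u0 i : 0 <= u i by rewrite ltW// monom_gt0.
have v0 j : 0 <= v j by rewrite ltW// monom_gt0.
pose N := 1 + (\sum_i u i + \sum_j v j).
have N0 : 0 < N by rewrite ltr_pwDl// addr_ge0// sumr_ge0.
have eta0 : 0 < - signomial Ap Am c x / N by rewrite divr_gt0// oppr_gt0.
have [c' [[_ cop] /ball_rV cc]] := clc _ (nbhsx_ballx c _ eta0).
have := signed_sum_perturb c c' u v _ u0 v0 (fun k => ltW (cc k)).
have f0 : 0 <= signed_sum c' u v by exact: cop.
have fE : signed_sum c u v = signomial Ap Am c x by [].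
have : - signomial Ap Am c x / N * (\sum_i u i + \sum_j v j) < - signomial Ap Am c x.
  by rewrite mulrAC ltr_pdivrMr// ltr_pM2l ?oppr_gt0// /N ltrDr.
by rewrite fE ler_norml => lt /andP[lo _]; lra.
Qed.

Lemma nabla_pos_sub_boundary : nonseparable Ap Am ->
  nabla_pos Ap Am `<=` C_SONC Ap Am ->
  nabla_pos Ap Am `<=` rel_boundary (@poscoef R _) (C_copos Ap Am).
Proof.
move=> ns nS c nc; have [c0 [x [x0 [fx _]]]] := nc.
have [_ /copositive_SONC cop] := nS _ nc.
split=> //; split; first exact: subset_closure.
move=> /nbhs_ballP[e /= e0 eC]; have [i0 _] := nonseparable_inhabited ns.
have e2 : 0 < e / 2 by rewrite divr_gt0.
(* Taking half the radius off the coefficient of one point of A_+ stays in the ball and makes the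
   value at [x] negative. *)
pose c' : 'rV[R]_(p + m) := \row_k (c 0 k - e / 2 * (k == lshift m i0)%:R).
have [|_ /(_ x x0)] := eC c'.
  split=> // i k; rewrite ord1 -ball_normE /= mxE opprB addrC subrK.
  rewrite normrM gtr0_norm//; case: eqP => _; rewrite ?normr1 ?normr0; lra.
suff -> : signomial Ap Am c' x = signomial Ap Am c x - e / 2 * monom (Ap i0) x.
  by rewrite fx sub0r oppr_ge0 leNgt mulr_gt0// monom_gt0.
rewrite /signomial addrAC; congr (_ - _); last first.
  by apply: eq_bigr => j _; rewrite mxE eq_rlshift mulr0 subr0.
under eq_bigr do rewrite mxE eq_lshift mulrBl.
rewrite sumrB; congr (_ - _); rewrite (bigD1 i0)//= eqxx mulr1 big1 ?addr0//.
by move=> i ii; rewrite (negbTE ii) mulr0 mul0r.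
Qed.

(** * Coercivity and rescaling by a monomial *)

Section Compactness.
Variable t : 'I_m -> 'I_p -> R.
Hypothesis t0 : forall j i, 0 < t j i.
Hypothesis t1 : forall j, \sum_i t j i = 1.
Hypothesis tE : forall j, Am j = \sum_i t j i *: Ap i.
Variable i0 : 'I_p.

(** Every [Am j] has weight at least [tau] on [Ap i'], so its exponent falls short of the maximum
    [M] by at least [tau * D]. Nonpositivity forces [lo * exp M] below [m * hi * exp (M - tau * D)],
    and [x <= exp x] turns this into a bound on [D]. *)
Lemma coercive_bound (tau lo hi : R) c z :
  0 < tau -> (forall j i, tau <= t j i) ->
  0 < lo -> (forall k, lo <= c 0 k <= hi) ->
  signed_sum c (fun i => expR (dotv z (Ap i))) (fun j => expR (dotv z (Am j))) <= 0 ->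
  forall i i', dotv z (Ap i) - dotv z (Ap i') <= m%:R * hi / (lo * tau).
Proof.
move=> tau0 taut lo0 chi f0 i i'.
case: (arg_maxP (fun i => dotv z (Ap i)) (erefl : xpredT i)) => i1 _ imax.
pose M := dotv z (Ap i1); pose D := M - dotv z (Ap i').
apply: (@le_trans _ _ D); first by rewrite lerD2r; exact: imax.
have hi0 : 0 <= hi.
  by have /andP[l h] := chi (lshift m i); exact: le_trans (ltW lo0) (le_trans l h).
have bD j : dotv z (Am j) <= M - tau * D.
  have D0 k : 0 <= M - dotv z (Ap k) by rewrite subr_ge0; exact: imax.
  have : tau * D <= \sum_k t j k * (M - dotv z (Ap k)).
    rewrite (bigD1 i')//= (@le_trans _ _ (t j i' * D))//; first by rewrite ler_wpM2r//; exact: D0.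
    by rewrite lerDl sumr_ge0// => k _; rewrite mulr_ge0// ltW.
  under eq_bigr do rewrite mulrBr.
  by rewrite sumrB -mulr_suml t1 mul1r -dotv_sumr -tE; lra.
have h1 : lo * expR M <= \sum_i c 0 (lshift m i) * expR (dotv z (Ap i)).
  have cge k : 0 <= c 0 k by have /andP[l _] := chi k; exact: le_trans (ltW lo0) l.
  rewrite (bigD1 i1)//= (@le_trans _ _ (c 0 (lshift m i1) * expR M))//.
    by rewrite ler_wpM2r ?expR_ge0//; have /andP[] := chi (lshift m i1).
  by rewrite lerDl sumr_ge0// => k _; rewrite mulr_ge0// expR_ge0.
have h2 : \sum_j c 0 (rshift p j) * expR (dotv z (Am j)) <=
    m%:R * hi * expR (M - tau * D).
  have -> : m%:R * hi * expR (M - tau * D) = \sum_(j < m) hi * expR (M - tau * D).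
    by rewrite sumr_const card_ord -[RHS]mulr_natl mulrA.
  apply: ler_sum => j _; have /andP[l h] := chi (rshift p j).
  rewrite ler_pM ?expR_ge0 ?ler_expR//; exact: (le_trans (ltW lo0)).
have : lo * expR M <= m%:R * hi * expR (M - tau * D).
  by apply: (le_trans h1); apply: le_trans h2; rewrite -subr_le0.
have -> : expR M = expR (tau * D) * expR (M - tau * D).
  by rewrite -expRD addrC subrK.
rewrite mulrA ler_pM2r ?expR_gt0// => h3.
rewrite ler_pdivlMr ?mulr_gt0//; apply: le_trans h3.
have -> : D * (lo * tau) = lo * (tau * D) by ring.
rewrite ler_pM2l//; by apply: le_trans (expR_ge1Dx _); rewrite lerDr.
Qed.

(** Its left kernel consists of the directions along which all positive exponents agree. *)
Definition diffmx : 'M[R]_(n, p) := \matrix_(k, i) (Ap i 0 k - Ap i0 0 k).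

Lemma mul_diffmx z i : (z *m diffmx) 0 i = dotv z (Ap i) - dotv z (Ap i0).
Proof.
by rewrite -dotvBr mxE; apply: eq_bigr => k _; rewrite !mxE.
Qed.

(** The signomial divided by the monomial of [Ap i0]: [y] stands for the exponent differences, and
    the weights [t] express the negative exponents through them. *)
Definition homog c (y : 'rV[R]_p) : R :=
  signed_sum c (fun i => expR (y 0 i)) (fun j => expR (\sum_i t j i * y 0 i)).

Lemma signomial_homog c z :
  signed_sum c (fun i => expR (dotv z (Ap i))) (fun j => expR (dotv z (Am j))) =
  expR (dotv z (Ap i0)) * homog c (z *m diffmx).
Proof.
rewrite /homog /signed_sum mulrBr !mulr_sumr; congr (_ - _).
  apply: eq_bigr => i _; rewrite mul_diffmx mulrCA -expRD; congr (_ * expR _).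
  by ring.
apply: eq_bigr => j _; rewrite mulrCA -expRD; congr (_ * expR _).
under eq_bigr do rewrite mul_diffmx mulrBr.
by rewrite sumrB -mulr_suml t1 -dotv_sumr -tE; ring.
Qed.

Lemma continuous_lincomb (I : finType) (d : I -> R) (f : I -> 'rV[R]_p -> R) :
  (forall i, continuous (f i)) -> continuous (fun y => \sum_i d i * f i y).
Proof.
move=> cf; elim: (index_enum I) => [|i r IH].
  by under eq_fun do rewrite big_nil; exact: cst_continuous.
under eq_fun do rewrite big_cons.
by move=> y; exact: (@cvgD _ _ _ _ (nbhs_filter y) _ _ _ _
  (@cvgMl_tmp _ _ _ (nbhs_filter y) _ (d i) _ (cf i y)) (IH y)).
Qed.

Lemma continuous_homog_mul c (Q : 'M[R]_p) :
  continuous (fun y : 'rV[R]_p => homog c (y *m Q)).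
Proof.
have cQ i : continuous (fun y : 'rV[R]_p => (y *m Q) 0 i).
  have -> : (fun y : 'rV[R]_p => (y *m Q) 0 i) = fun y => \sum_k Q k i * y 0 k.
    by apply/funext => y; rewrite mxE; apply: eq_bigr => k _; rewrite mulrC.
  by apply: continuous_lincomb => k; exact: coord_continuous.
have cE (f : 'rV[R]_p -> R) : continuous f -> continuous (fun y => expR (f y)).
  by move=> cf y; exact: (continuous_cvg _ (@continuous_expR R (f y)) (cf y)).
move=> y; apply: (@cvgB _ _ _ _ (nbhs_filter y)).
  by apply: continuous_lincomb => i; exact: cE.
by apply: continuous_lincomb => j; apply: cE; exact: continuous_lincomb.
Qed.

End Compactness.

End CopositiveBoundary.

(** * Strictly positive signomials are interior *)

Section Interior.
Variables (R : realType) (n p m : nat).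
Variables (Ap : 'I_p -> 'rV[R]_n) (Am : 'I_m -> 'rV[R]_n).
Implicit Types (c : 'rV[R]_(p + m)) (z x : 'rV[R]_n).

Definition expv z : 'rV[R]_n := \row_k expR (z 0 k).

Lemma posorth_expv z : posorth (expv z).
Proof. by move=> k; rewrite mxE expR_gt0. Qed.

Lemma expvK z : logv R n (expv z) = z.
Proof. by apply/rowP => k; rewrite !mxE expRK. Qed.

Lemma signomial_logv c x : posorth x -> signomial Ap Am c x =
  signed_sum R p m c (fun i => expR (dotv (logv R n x) (Ap i)))
                     (fun j => expR (dotv (logv R n x) (Am j))).
Proof.
by move=> x0; congr (_ - _); apply: eq_bigr => i _; rewrite monomE.
Qed.

(* By [coercive_bound] only points whose exponent differences lie in a fixed
   compact box matter; there the rescaled signomial has a positive minimum. *)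
Lemma interior_C_copos c : nonseparable Ap Am -> poscoef c ->
  (forall x, posorth x -> 0 < signomial Ap Am c x) ->
  interior (C_copos Ap Am) c.
Proof.
move=> ns c0 fpos; have [i0 _] := nonseparable_inhabited R n p m Ap Am ns.
have [t ht] := choice (fun j => relint_pos_weights R n p Ap (Am j) (ns.1 j)).
have t0 j i : 0 < t j i by have [] := ht j.
have t1 j : \sum_i t j i = 1 by have [_ []] := ht j.
have tE j : Am j = \sum_i t j i *: Ap i by have [_ []] := ht j.
have [tau [tau0 taut]] := gt0_lower_bound R _ (fun k => t k.1 k.2)
  (fun k : 'I_m * 'I_p => t0 k.1 k.2).
have [lo [lo0 loc]] := gt0_lower_bound R _ (fun k => c 0 k) c0.
(* The summand [lo] leaves room for perturbed coefficients. *)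
pose hi := lo + \sum_k c 0 k.
have chi k : c 0 k + lo <= hi.
  rewrite /hi addrC lerD2l (bigD1 k)//= lerDl sumr_ge0// => k' _.
  exact: ltW (c0 k').
have hi0 : 0 <= hi by rewrite addr_ge0 ?sumr_ge0 ?(ltW lo0)// => k _; exact: ltW (c0 k).
pose K := m%:R * hi / (lo / 2 * tau).
have K0 : 0 <= K by rewrite divr_ge0 ?mulr_ge0// ltW// divr_gt0.
(* [P *m A] projects onto the image of [A], so [phi] is positive on the whole space, whereas
   positivity of [homog] is available on that image only. *)
pose A := diffmx R n p Ap i0; pose P := pinvmx A.
pose phi (y : 'rV[R]_p) := homog R p m t c (y *m (P *m A)).
have phi_gt0 y : 0 < phi y.
  have := fpos _ (posorth_expv (y *m P)).
  rewrite signomial_logv ?expvK; last exact: posorth_expv.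
  rewrite (signomial_homog R n p m Ap Am t t1 tE i0) pmulr_rgt0 ?expR_gt0//.
  by rewrite /phi (mulmxA y P A).
have [| | |y _ ymin] := @EVT_min_rV R p phi
    [set y | forall i, `[- K, K]%classic (y ord0 i)].
- exists 0 => i; rewrite mxE /= in_itv /= K0 andbT; lra.
- exact: (@rV_compact R p (fun=> `[- K, K]%classic) (fun=> @segment_compact R _ _)).
- by apply: continuous_subspaceT; exact: continuous_homog_mul.
pose N := (p%:R + m%:R) * expR K.
have N0 : 0 < N.
  by rewrite mulr_gt0 ?expR_gt0// ltr_wpDr// ltr0n (leq_trans _ (ltn_ord i0)).
(* The first bound keeps the coefficients at least [lo / 2]; the second keeps the change of the
   rescaled value on the box at most the minimum [phi y]. *)
pose eta := Num.min (lo / 2) (phi y / N).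
have eta0 : 0 < eta by rewrite lt_min !divr_gt0.
apply/nbhs_ballP; exists eta => //= c' /ball_rV cc.
have lo' k : lo / 2 <= c' 0 k <= hi.
  have := cc k; rewrite lt_min => /andP[+ _]; rewrite ltr_norml => /andP[h1 h2].
  have := chi k; have := loc k; move=> h3 h4; apply/andP; split; lra.
split=> [k|x x0]; first by have /andP[h _] := lo' k; apply: lt_le_trans h; lra.
rewrite leNgt; apply/negP => fx.
pose z := logv R n x; pose w := z *m A.
have lo20 : 0 < lo / 2 by rewrite divr_gt0.
rewrite signomial_logv// in fx.
have bnd := coercive_bound R n p m Ap Am t t0 t1 tE tau (lo / 2) hi c' z tau0
  (fun j i => taut (j, i)) lo20 lo' (ltW fx).
(* Comparing [Ap i] with [Ap i0] in both orders gives the two bounds. *)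
have wK i : - K <= w 0 i <= K.
  rewrite mul_diffmx bnd andbT -[X in _ <= X]opprB lerN2; exact: bnd.
have phiw : phi w = homog R p m t c w.
  by rewrite /phi (mulmxA w P A) mulmxKpV// submxMl.
have := ymin w; rewrite inE phiw => /(_ wK) => dw.
rewrite (signomial_homog R n p m Ap Am t t1 tE i0) pmulr_rlt0 ?expR_gt0// in fx.
have sumK (I : finType) (g : I -> R) : (forall i, g i <= K) ->
    \sum_i expR (g i) <= #|I|%:R * expR K.
  move=> gK; rewrite mulr_natl -sumr_const.
  by apply: ler_sum => i _; rewrite ler_expR.
have := signed_sum_perturb R p m c c' (fun i => expR (w 0 i))
  (fun j => expR (\sum_i t j i * w 0 i)) eta
  (fun i => expR_ge0 _) (fun j => expR_ge0 _) (fun k => ltW (cc k)).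
rewrite -/(homog R p m t c w) -/(homog R p m t c' w).
have : eta * (\sum_i expR (w 0 i) + \sum_j expR (\sum_i t j i * w 0 i)) <= phi y.
  apply: (@le_trans _ _ (eta * N)); last first.
    by rewrite -ler_pdivlMr// /eta ge_min lexx orbT.
  rewrite ler_pM2l// /N mulrDl; apply: lerD.
    rewrite -[X in X%:R]card_ord; apply: sumK => i.
    by have /andP[] := wK i.
  rewrite -[X in X%:R]card_ord; apply: sumK => j.
  rewrite -[X in _ <= X]mul1r -(t1 j) mulr_suml; apply: ler_sum => i _.
  by rewrite ler_wpM2l ?(ltW (t0 _ _))//; have /andP[] := wK i.
(* The rescaled value would fall from at least [phi y] to below 0, more than the perturbation
   allows. *)
by move=> h1; rewrite ler_norml => /andP[_ h2]; lra.
Qed.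

Lemma boundary_sub_nabla_pos : nonseparable Ap Am ->
  rel_boundary (@poscoef R _) (C_copos Ap Am) `<=` nabla_pos Ap Am.
Proof.
move=> ns c [c0 [/closure_C_copos cop nint]]; split=> //.
apply: contrapT => nsing; apply: nint; apply: interior_C_copos => // x x0.
rewrite lt_def cop// andbT; apply/eqP => fx; apply: nsing; exists x.
exact: Sing_pos_min.
Qed.

End Interior.

Theorem theorem3p14 (R : realType) (n p m : nat)
  (Ap : 'I_p -> 'rV[R]_n) (Am : 'I_m -> 'rV[R]_n) :
  signed_support Ap Am -> nonseparable Ap Am ->
  (forall c : 'rV[R]_(p + m), poscoef c ->
     Sing_pos (signomial Ap Am c) !=set0 -> SONC (signomial Ap Am c)) /\
  ((forall i k, Ap i 0 k \is a Num.int) -> (forall j k, Am j 0 k \is a Num.int) ->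
     nabla_pos Ap Am `<=` C_SONC Ap Am /\
     nabla_pos Ap Am = rel_boundary (@poscoef R _) (C_copos Ap Am)).
Proof.
move=> ss ns.
have singS c : poscoef c -> Sing_pos (signomial Ap Am c) !=set0 ->
  SONC (signomial Ap Am c) by exact: SONC_of_Sing_pos.
have nablaS : nabla_pos Ap Am `<=` C_SONC Ap Am.
  by move=> c [c0 Sc]; split=> //; exact: singS.
split=> // _ _; split=> //; apply/seteqP; split.
  exact: nabla_pos_sub_boundary.
exact: boundary_sub_nabla_pos.
Qed.
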